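(* Every manifold $M$ of dimension $n>3$ of comprehensive quasi-constant curvature is a $Co(QE)_n$.
   Context: The curvature tensor $R$ of type $(0,4)$ has the sign convention that the Ricci tensor is $S(Y,Z)=\sum_i R(e_i,Y,Z,e_i)$ for an orthonormal frame $\{e_i\}$. For $n>3$, conformally flat means that the Weyl tensor vanishes. For a symmetric $(0,2)$-tensor $h$ put $$(g\wedge h)(X,Y,Z,W)=h(X,W)g(Y,Z)-h(Y,W)g(X,Z)+h(Y,Z)g(X,W)-h(X,Z)g(Y,W),$$ and for $1$-forms $\alpha,\beta$ put $(\alpha\odot\beta)(X,Y)=\alpha(X)\beta(Y)+\beta(X)\alpha(Y)$. A Riemannian manifold $(M,g)$ of dimension $n>2$ is of comprehensive quasi-constant curvature if it is conformally flat and $$R(X,Y,Z,W)=a_1\bigl(g(X,W)g(Y,Z)-g(Y,W)g(X,Z)\bigr)+(g\wedge h)(X,Y,Z,W),$$ where $$h=a_2d_1+a_3d_2+a_4\,\omega^1\otimes\omega^1+a_5\,\omega^2\otimes\omega^2+a_6\,\omega^3\otimes\omega^3+a_7\,\omega^4\otimes\omega^4+a_8\,\omega^1\odot\omega^2+a_9\,\omega^1\odot\omega^4+a_{10}\,\omega^2\odot\omega^3+a_{11}\,\omega^2\odot\omega^4+a_{12}\,\omega^3\odot\omega^1+a_{13}\,\omega^3\odot\omega^4,$$ $a_1,\dots,a_{13}$ are non-zero scalars (functions), $\omega^1,\dots,\omega^4$ are $1$-forms whose dual vector fields $W_1,\dots,W_4$ ($g(X,W_i)=\omega^i(X)$) satisfy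 $g(W_i,W_j)=\delta_{ij}$, and $d_1,d_2$ are symmetric trace-free $(0,2)$-tensors with $d_1(X,W_1)=d_2(X,W_1)=0$ for all $X$. A $Co(QE)_n$ (comprehensive quasi Einstein manifold) is a non-flat $n$-dimensional Riemannian manifold $(M,g)$ whose Ricci tensor $S$ is non-zero and satisfies $$S(X,Y)=a\,g(X,Y)+\sum_{i,j=1}^4 b_{ij}\,\omega^i(X)\omega^j(Y)+c_1d_1(X,Y)+c_2d_2(X,Y)$$ for all $X,Y$, where $a,b_{ij}=b_{ji},c_1,c_2$ are scalars (functions on $M$), $\omega^1,\dots,\omega^4$ are non-zero $1$-forms, $W_1,\dots,W_4$ are vector fields with $g(X,W_i)=\omega^i(X)$ and $g(W_i,W_j)=\delta_{ij}$, and $d_1,d_2$ are symmetric $(0,2)$-tensors with $\operatorname{trace} d_1=\operatorname{trace} d_2=0$ and $d_1(X,W_1)=d_2(X,W_1)=0$ for all $X$. *)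

(* Defs.v *)
From HB Require Import structures.
From mathcomp Require Import all_boot all_order all_algebra.
From mathcomp Require Import all_classical all_reals all_analysis.

Set Implicit Arguments.
Unset Strict Implicit.
Unset Printing Implicit Defensive.

Import Order.TTheory GRing.Theory Num.Theory.
Import numFieldNormedType.Exports.

Local Open Scope classical_set_scope.
Local Open Scope ring_scope.

Section Calculus.
Variables (R : realType) (n : nat).
Implicit Types (U : set 'rV[R]_n) (f : 'rV[R]_n -> R).

Definition partial (j : 'I_n) f (x : 'rV[R]_n) : R :=
  'D_(delta_mx 0 j) (f : 'rV[R]_n -> R^o) x.

Fixpoint Ck (k : nat) U f : Prop :=
  (forall x, U x -> {for x, continuous f}) /\
  if k is k'.+1 then
    forall j : 'I_n,
      (forall x, U x -> derivable (f : 'rV[R]_n -> R^o) x (delta_mx 0 j)) /\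
      Ck k' U (partial j f)
  else True.

(* C^infinity on the open set U; values outside U are irrelevant. *)
Definition smooth_on U f : Prop := forall k, Ck k U f.

End Calculus.

(* Tangent vectors are row vectors of components, a bilinear form is its
   matrix, an orthonormal frame is the matrix whose rows are its vectors. *)

Section Frames.
Variables (R : realType) (n : nat).
Implicit Types (G T E : 'M[R]_n) (x y : 'rV[R]_n).

Definition bil T x y : R := (x *m T *m y^T) 0 0.

Definition sym_form T : Prop := forall x y, bil T x y = bil T y x.

Definition posdef_form G : Prop := forall x, x != 0 -> 0 < bil G x x.

Definition orthonormal_frame G E : Prop :=
  forall i j, bil G (row i E) (row j E) = (i == j)%:R.

(* Some orthonormal frame for G; it exists by [some_frameP], and traces do not
   depend on it by [metric_trace_frame]. *)
Definition some_frame G : 'M[R]_n :=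
  xget 1%:M [set E | orthonormal_frame G E].

(* \sum_i B(e_i, e_i) for an orthonormal frame (e_i). *)
Definition metric_trace G (B : 'rV[R]_n -> 'rV[R]_n -> R) : R :=
  \sum_i B (row i (some_frame G)) (row i (some_frame G)).

Lemma bil_rows m p T (A : 'M[R]_(m, n)) (B : 'M[R]_(p, n)) i j :
  bil T (row i A) (row j B) = (A *m T *m B^T) i j.
Proof.
rewrite /bil -row_mul [LHS]mxE [RHS]mxE; apply: eq_bigr => k _.
by rewrite [row _ _ _ _]mxE; congr (_ * _); rewrite !mxE.
Qed.

Lemma orthonormal_frameE G E :
  orthonormal_frame G E <-> E *m G *m E^T = 1%:M.
Proof.
split=> [h|h i j]; last by rewrite bil_rows h mxE.
by apply/matrixP => i j; rewrite -bil_rows h mxE.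
Qed.

Lemma orthonormal_rows_exist G (k : nat) :
  sym_form G -> posdef_form G -> (k <= n)%N ->
  exists E : 'M[R]_(k, n), E *m G *m E^T = 1%:M.
Proof.
move=> sG pG; elim: k => [|k IH] kn.
  by exists 0; apply/matrixP => -[].
have [E hE] := IH (ltnW kn).
have hk : kermx (G *m E^T) != 0.
  rewrite -mxrank_eq0 mxrank_ker subn_eq0 -ltnNge.
  exact: leq_ltn_trans (rank_leq_col _) kn.
have [i hv] : exists i, row i (kermx (G *m E^T)) != 0.
  apply: contrapT => h; move/negP: hk; apply; apply/eqP/row_matrixP => i.
  rewrite row0; apply/eqP; apply: contrapT => hi.
  by apply: h; exists i; apply/negP.
set v := row i _ in hv.
have vE : v *m G *m E^T = 0.
  by rewrite -mulmxA /v -row_mul mulmx_ker row0.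
have Gt : G^T = G.
  apply/matrixP => a b; rewrite mxE.
  have := sG (row b 1%:M) (row a 1%:M).
  by rewrite !bil_rows trmx1 !mul1mx !mulmx1.
have Ev : E *m G *m v^T = 0.
  by rewrite -[RHS](trmx0 _ 1 k) -vE !trmx_mul trmxK Gt mulmxA.
have vv := pG _ hv.
pose c := (Num.sqrt (bil G v v))^-1.
have cc : c * c * bil G v v = 1.
  rewrite /c -invfM -expr2 sqr_sqrtr ?ltW // mulVf //.
  by rewrite gt_eqF.
exists (castmx (addn1 k, erefl n) (col_mx E (c *: v))).
case: _ / (addn1 k); rewrite castmx_id.
rewrite mul_col_mx tr_col_mx mul_col_row hE.
rewrite linearZ /= -!scalemxAr Ev scaler0.
rewrite -!scalemxAl vE scaler0 scalerA.
suff -> : (c * c) *: (v *m G *m v^T) = 1%:M by rewrite -scalar_mx_block.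
apply/matrixP => a b; rewrite !ord1 [LHS]mxE [in RHS]mxE.
exact: cc.
Qed.

Lemma some_frameP G :
  sym_form G -> posdef_form G -> orthonormal_frame G (some_frame G).
Proof.
move=> sG pG; have [E hE] := orthonormal_rows_exist sG pG (leqnn n).
by apply: (@xgetPex _ 1%:M [set E | orthonormal_frame G E]); exists E; apply/orthonormal_frameE.
Qed.

Lemma metric_trace_frame G T E :
  sym_form G -> posdef_form G -> orthonormal_frame G E ->
  metric_trace G (bil T) = \sum_i bil T (row i E) (row i E).
Proof.
move=> sG pG; have := some_frameP sG pG.
rewrite /metric_trace; set F := some_frame G.
have key (A : 'M[R]_n) : orthonormal_frame G A ->
    \sum_i bil T (row i A) (row i A) = \tr (T *m invmx G).
  move/orthonormal_frameE => hA.
  have -> : \sum_i bil T (row i A) (row i A) = \tr (A *m (T *m A^T)).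
    by rewrite mulmxA; apply: eq_bigr => i _; rewrite bil_rows.
  rewrite mxtrace_mulC -mulmxA; congr (\tr (T *m _)).
  have h : G *m (A^T *m A) = 1%:M.
    by rewrite mulmxA; apply: mulmx1C; rewrite mulmxA.
  have Gu : G \in unitmx by case/mulmx1_unit: h.
  by rewrite -[LHS]mul1mx -(mulVmx Gu) -mulmxA h mulmx1.
by move=> hF hE; rewrite !key.
Qed.

End Frames.

(* [coord c] is the coordinate map of the chart c on its domain [dom c], and
   [point c] its inverse; both are total functions with junk values elsewhere. *)
Record smooth_manifold (R : realType) (n : nat) := SmoothManifold {
  carrier :> topologicalType;
  hausdorff_carrier : hausdorff_space carrier;
  countable_carrier : @second_countable carrier;
  chart : Type;
  dom : chart -> set carrier;
  coord : chart -> carrier -> 'rV[R]_n;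
  point : chart -> 'rV[R]_n -> carrier;
  dom_cover : forall p, exists c, dom c p;
  dom_open : forall c, open (dom c);
  image_open : forall c, open (coord c @` dom c);
  coordK : forall c p, dom c p -> point c (coord c p) = p;
  coord_continuous : forall c p, dom c p -> {for p, continuous (coord c)};
  point_continuous : forall c x,
    (coord c @` dom c) x -> {for x, continuous (point c)};
  transition_smooth : forall c d (j : 'I_n),
    smooth_on (coord c @` (dom c `&` dom d))
              (fun x => coord d (point c x) 0 j)
}.

Section Tensors.
Variables (R : realType) (n : nat) (M : smooth_manifold R n).
Implicit Types (c d : chart M) (p : M).

Definition smooth_in_chart c (f : M -> R) : Prop :=
  smooth_on (coord c @` dom c) (f \o @point _ _ M c).

Definition smooth_function (f : M -> R) : Prop :=
  forall c, smooth_in_chart c f.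

Definition nonzero_function (f : M -> R) : Prop := exists p, f p != 0.

(* The partial derivative of f at p with respect to the i-th coordinate of c. *)
Definition pd c (i : 'I_n) (f : M -> R) p : R :=
  partial i (f \o @point _ _ M c) (coord c p).

(* (dy^j / dx^i)_(i, j), where x are the coordinates of c and y those of d. *)
Definition jacobian c d p : 'M[R]_n :=
  \matrix_(i, j) pd c i (fun q => coord d q 0 j) p.

(* A tensor field is given by its components in every chart at every point of
   the domain of the chart, subject to the classical transformation law. *)
Record vector_field := VectorField {
  vcomp :> chart M -> M -> 'rV[R]_n;
  vcomp_smooth : forall c i, smooth_in_chart c (fun p => vcomp c p 0 i);
  vcomp_change : forall c d p, dom c p -> dom d p ->
    vcomp d p = vcomp c p *m jacobian c d p
}.

Record one_form := OneForm {
  fcomp : chart M -> M -> 'rV[R]_n;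
  fcomp_smooth : forall c i, smooth_in_chart c (fun p => fcomp c p 0 i);
  fcomp_change : forall c d p, dom c p -> dom d p ->
    fcomp c p = fcomp d p *m (jacobian c d p)^T
}.

Record tensor2 := Tensor2 {
  tcomp :> chart M -> M -> 'M[R]_n;
  tcomp_smooth : forall c i j, smooth_in_chart c (fun p => tcomp c p i j);
  tcomp_change : forall c d p, dom c p -> dom d p ->
    tcomp c p = jacobian c d p *m tcomp d p *m (jacobian c d p)^T
}.

(* The value of a 1-form on the tangent vector at p with components x in c. *)
Definition form_eval (al : one_form) c p (x : 'rV[R]_n) : R :=
  \sum_i fcomp al c p 0 i * x 0 i.

Definition nonzero_form (al : one_form) : Prop :=
  exists c p x, dom c p /\ form_eval al c p x != 0.

Definition symmetric_tensor (T : tensor2) : Prop :=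
  forall c p, dom c p -> sym_form (T c p).

End Tensors.

Record riemannian_manifold (R : realType) (n : nat) := RiemannianManifold {
  base :> smooth_manifold R n;
  metric : tensor2 base;
  metric_sym : symmetric_tensor metric;
  metric_posdef : forall (c : chart base) (p : base),
    dom c p -> posdef_form (metric c p)
}.

Section Curvature.
Variables (R : realType) (n : nat) (M : riemannian_manifold R n).
Implicit Types (c : chart M) (p : M) (x y z w : 'rV[R]_n).

Definition g c p x y : R := bil (metric M c p) x y.

(* christoffel c k i j is Gamma^k_(ij) of the Levi-Civita connection. *)
Definition christoffel c (k i j : 'I_n) p : R :=
  2%:R^-1 * \sum_l invmx (metric M c p) k l *
    (pd c i (fun q => metric M c q j l) p + pd c j (fun q => metric M c q i l) p
     - pd c l (fun q => metric M c q i j) p).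

(* The d_l-component of R(d_i, d_j)d_k, where
   R(X, Y)Z = nabla_X nabla_Y Z - nabla_Y nabla_X Z - nabla_[X, Y] Z. *)
Definition riemann_comp c (l i j k : 'I_n) p : R :=
  pd c i (christoffel c l j k) p - pd c j (christoffel c l i k) p
  + \sum_m (christoffel c l i m p * christoffel c m j k p
            - christoffel c l j m p * christoffel c m i k p).

Definition curvature_op c p x y z : 'rV[R]_n :=
  \row_l \sum_i \sum_j \sum_k x 0 i * y 0 j * z 0 k * riemann_comp c l i j k p.

(* R(X, Y, Z, W) = g(R(X, Y)Z, W): with this convention and the contraction
   below, round spheres have positive Ricci tensor. *)
Definition curvature c p x y z w : R := g c p (curvature_op c p x y z) w.

Definition ricci c p y z : R :=
  metric_trace (metric M c p) (fun u v => curvature c p u y z v).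

Definition scalar_curvature c p : R :=
  metric_trace (metric M c p) (ricci c p).

(* (a ^ b)(X, Y, Z, W) for symmetric bilinear forms a and b. *)
Definition wedge (a b : 'rV[R]_n -> 'rV[R]_n -> R) x y z w : R :=
  b x w * a y z - b y w * a x z + b y z * a x w - b x z * a y w.

Definition gg c p x y z w : R :=
  g c p x w * g c p y z - g c p y w * g c p x z.

Definition weyl c p x y z w : R :=
  curvature c p x y z w
  - (n%:R - 2%:R)^-1 * wedge (g c p) (ricci c p) x y z w
  + scalar_curvature c p / ((n%:R - 1) * (n%:R - 2%:R)) * gg c p x y z w.

Definition flat : Prop :=
  forall c p, dom c p -> forall x y z w, curvature c p x y z w = 0.

Definition ricci_nonzero : Prop :=
  exists c p x y, dom c p /\ ricci c p x y != 0.

(* The appropriate notion for n > 3 only. *)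
Definition conformally_flat : Prop :=
  forall c p, dom c p -> forall x y z w, weyl c p x y z w = 0.

Definition trace_free (T : tensor2 M) : Prop :=
  forall c p, dom c p -> metric_trace (metric M c p) (bil (T c p)) = 0.

(* The index i : 'I_4 stands for i + 1. *)
Definition structure_tensors (om : 'I_4 -> one_form M)
    (W : 'I_4 -> vector_field M) (d1 d2 : tensor2 M) : Prop :=
  [/\ forall i c p x, dom c p -> g c p x (W i c p) = form_eval (om i) c p x,
      forall i j c p, dom c p -> g c p (W i c p) (W j c p) = (i == j)%:R,
      symmetric_tensor d1 /\ symmetric_tensor d2,
      trace_free d1 /\ trace_free d2
    & forall c p x, dom c p ->
        bil (d1 c p) x (W 0 c p) = 0 /\ bil (d2 c p) x (W 0 c p) = 0].

(* (alpha (.) beta)(X, Y), without a factor 1/2. *)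
Definition sym_prod (al be : one_form M) c p x y : R :=
  form_eval al c p x * form_eval be c p y
  + form_eval be c p x * form_eval al c p y.

Definition tens_prod (al be : one_form M) c p x y : R :=
  form_eval al c p x * form_eval be c p y.

Definition h_form (a : nat -> M -> R) (om : 'I_4 -> one_form M)
    (d1 d2 : tensor2 M) c p x y : R :=
  let om1 := om 0 in let om2 := om 1 in
  let om3 := om 2%:R in let om4 := om 3%:R in
  a 2%N p * bil (d1 c p) x y + a 3%N p * bil (d2 c p) x y
  + a 4%N p * tens_prod om1 om1 c p x y + a 5%N p * tens_prod om2 om2 c p x y
  + a 6%N p * tens_prod om3 om3 c p x y + a 7%N p * tens_prod om4 om4 c p x y
  + a 8%N p * sym_prod om1 om2 c p x y + a 9%N p * sym_prod om1 om4 c p x y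
  + a 10%N p * sym_prod om2 om3 c p x y + a 11%N p * sym_prod om2 om4 c p x y
  + a 12%N p * sym_prod om3 om1 c p x y + a 13%N p * sym_prod om3 om4 c p x y.

(* Only a 1, ..., a 13 matter.  As for the Ricci tensor and the curvature
   tensor below, a scalar is non-zero if it does not vanish identically. *)
Definition comprehensive_quasi_constant_curvature : Prop :=
  conformally_flat /\
  exists (a : nat -> M -> R) (om : 'I_4 -> one_form M)
         (W : 'I_4 -> vector_field M) (d1 d2 : tensor2 M),
  [/\ forall i, (1 <= i <= 13)%N ->
        smooth_function (a i) /\ nonzero_function (a i),
      structure_tensors om W d1 d2
    & forall c p, dom c p -> forall x y z w,
        curvature c p x y z w =
          a 1%N p * gg c p x y z w
          + wedge (g c p) (h_form a om d1 d2 c p) x y z w].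

Definition comprehensive_quasi_Einstein : Prop :=
  [/\ ~ flat, ricci_nonzero
    & exists (a : M -> R) (b : 'I_4 -> 'I_4 -> M -> R) (c1 c2 : M -> R)
             (om : 'I_4 -> one_form M) (W : 'I_4 -> vector_field M)
             (d1 d2 : tensor2 M),
      [/\ [/\ smooth_function a, forall i j, smooth_function (b i j),
              smooth_function c1 & smooth_function c2],
          forall i j p, b i j p = b j i p,
          forall i, nonzero_form (om i),
          structure_tensors om W d1 d2
        & forall c p, dom c p -> forall x y,
            ricci c p x y =
              a p * g c p x y
              + \sum_i \sum_j b i j p * form_eval (om i) c p x
                                      * form_eval (om j) c p y
              + c1 p * bil (d1 c p) x y + c2 p * bil (d2 c p) x y]].

End Curvature.

(* Main.v *)
(** Contracting the curvature formula over an orthonormal frame gives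
    S = ((n - 1) a_1 + tr h) g + (n - 2) h, where tr h = a_4 + a_5 + a_6 + a_7
    since d_1, d_2 are trace-free and the W_i are orthonormal; this has the
    required shape.  The Ricci tensor does not vanish, and so M is not flat,
    because S(W_2, W_1) = (n - 2) a_8: the metric term vanishes by
    orthogonality, and d_1, d_2 annihilate W_1. *)

Require Import Defs.
From mathcomp Require Import all_boot all_order all_algebra.
From mathcomp Require Import all_classical all_reals all_analysis.
From mathcomp Require Import ring.

Set Implicit Arguments.
Unset Strict Implicit.
Unset Printing Implicit Defensive.

Import Order.TTheory GRing.Theory Num.Theory.
Import numFieldNormedType.Exports.

Local Open Scope classical_set_scope.
Local Open Scope ring_scope.

(** * Smoothness of linear combinations with constant coefficients *)

Section Smoothness.
Variables (R : realType) (n : nat).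

(** Induction on [k]: the partial derivatives of [h] are the same combination of those of [f] and
    [g]. They are known only on [U], so [h] is prescribed only there; openness turns this into
    equality near each point, which continuity and derivatives respect. *)
Lemma Ck_lincomb (k : nat) (U : set 'rV[R]_n) (f g h : 'rV[R]_n -> R)
    (a b : R) :
  open U -> Ck k U f -> Ck k U g ->
  (forall x, U x -> h x = a * f x + b * g x) -> Ck k U h.
Proof.
move=> oU; have contE (f' g' h' : 'rV[R]_n -> R) :
    (forall x, U x -> {for x, continuous f'}) ->
    (forall x, U x -> {for x, continuous g'}) ->
    (forall x, U x -> h' x = a * f' x + b * g' x) ->
    forall x, U x -> {for x, continuous h'}.
  move=> cf cg hE x Ux.
  have la : {for x, continuous (cst a \* f')}.
    by apply: continuousM; [exact: cst_continuous|exact: cf].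
  have lb : {for x, continuous (cst b \* g')}.
    by apply: continuousM; [exact: cst_continuous|exact: cg].
  have lim := @continuousD R R^o _ _ _ x la lb.
  have nearE : \near x, (cst a \* f' + cst b \* g') x = h' x.
    by apply: filterS (open_nbhs_nbhs (conj oU Ux)) => y /hE ->.
  rewrite /prop_for /continuous_at hE //.
  exact: cvg_trans (near_eq_cvg nearE) lim.
elim: k f g h => [|k IH] f g h /= [cf df] [cg dg] hE;
  (split; first exact: contE cf cg hE) => //.
have nearE x : U x -> \near x, a * f x + b * g x = h x.
  by move=> Ux; apply: filterS (open_nbhs_nbhs (conj oU Ux)) => y /hE ->.
move=> j; have [dfj Cfj] := df j; have [dgj Cgj] := dg j.
pose F : 'rV[R]_n -> R^o := f; pose G : 'rV[R]_n -> R^o := g.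
have dF x : U x -> derivable (a \*: F) x (delta_mx 0 j).
  by move=> Ux; apply: derivableZ; exact: dfj.
have dG x : U x -> derivable (b \*: G) x (delta_mx 0 j).
  by move=> Ux; apply: derivableZ; exact: dgj.
have nE x : U x -> \near x, (a \*: F + b \*: G) x = (h : 'rV[R]_n -> R^o) x.
  exact: nearE.
split=> [x Ux|].
  exact: near_eq_derivable (nE x Ux) (derivableD (dF x Ux) (dG x Ux)).
apply: IH Cfj Cgj _ => x Ux; rewrite /partial.
rewrite -(near_eq_derive _ (nE x Ux)) (deriveD (dF x Ux) (dG x Ux)).
by rewrite (deriveZ a (dfj x Ux)) (deriveZ b (dgj x Ux)).
Qed.

Variable M : smooth_manifold R n.

Lemma smooth_function_lincomb (f g : M -> R) (a b : R) :
  smooth_function f -> smooth_function g ->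
  smooth_function (fun p => a * f p + b * g p).
Proof.
move=> sf sg c k; apply: Ck_lincomb (sf c k) (sg c k) _ => //.
exact: image_open.
Qed.

Lemma smooth_functionD (f g : M -> R) :
  smooth_function f -> smooth_function g ->
  smooth_function (fun p => f p + g p).
Proof.
move=> sf sg; have := smooth_function_lincomb 1 1 sf sg.
by congr smooth_function; apply/funext => p; rewrite !mul1r.
Qed.

Lemma smooth_functionZ (f : M -> R) (a : R) :
  smooth_function f -> smooth_function (fun p => a * f p).
Proof.
move=> sf; have := smooth_function_lincomb a 0 sf sf.
by congr smooth_function; apply/funext => p; rewrite mul0r addr0.
Qed.

End Smoothness.

(** * Linear algebra of contraction over an orthonormal frame *)

Section Contraction.
Variables (R : realType) (n : nat).
Implicit Types (G T E : 'M[R]_n) (x y : 'rV[R]_n).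

Lemma bilDm T T' x y : bil (T + T') x y = bil T x y + bil T' x y.
Proof. by rewrite /bil mulmxDr mulmxDl mxE. Qed.

Lemma bilZm (k : R) T x y : bil (k *: T) x y = k * bil T x y.
Proof. by rewrite /bil -scalemxAr -scalemxAl mxE. Qed.

Lemma bil_outer (u v x y : 'rV[R]_n) :
  bil (u^T *m v) x y = (\sum_i u 0 i * x 0 i) * (\sum_i v 0 i * y 0 i).
Proof.
rewrite /bil mulmxA -mulmxA mxE big_ord1 !mxE.
by congr (_ * _); apply: eq_bigr => i _; rewrite !mxE // mulrC.
Qed.

Lemma orthonormal_frame_inv G E :
  orthonormal_frame G E -> G *m (E^T *m E) = 1%:M.
Proof.
move=> /orthonormal_frameE hE.
by rewrite mulmxA; apply: mulmx1C; rewrite mulmxA.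
Qed.

Lemma orthonormal_frame_unitmx G E : orthonormal_frame G E -> G \in unitmx.
Proof. by move=> /orthonormal_frame_inv/mulmx1_unit[]. Qed.

(** Completeness of the frame: [E^T *m E] is the inverse metric, so summing over the frame vectors
    amounts to raising an index. *)
Lemma sum_bil_frame G T T' E x y : orthonormal_frame G E ->
  \sum_i bil T x (row i E) * bil T' (row i E) y =
  bil (T *m invmx G *m T') x y.
Proof.
move=> hE; have h := orthonormal_frame_inv hE.
have Gu := orthonormal_frame_unitmx hE.
have -> : invmx G = E^T *m E.
  by rewrite -[RHS]mul1mx -(mulVmx Gu) -mulmxA h mulmx1.
have -> : bil (T *m (E^T *m E) *m T') x y
    = ((x *m T *m E^T) *m (E *m T' *m y^T)) 0 0 by rewrite /bil !mulmxA.
rewrite mxE; apply: eq_bigr => i _.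
rewrite -[x in bil T x _](row_id 0) -[y in bil T' _ y](row_id 0).
by rewrite !bil_rows.
Qed.

(** The first and last slots are contracted. The trace of [G] is [n]; each of the two mixed terms of
    [wedge] returns [- T], whence [n - 2], and the mixed term of the first summand returns [- G],
    whence [n - 1]. *)
Lemma metric_trace_curvature G T (k : R) y z : sym_form G -> posdef_form G ->
  metric_trace G (fun u v =>
    k * (bil G u v * bil G y z - bil G y v * bil G u z)
    + wedge (bil G) (bil T) u y z v) =
  (k * (n%:R - 1) + metric_trace G (bil T)) * bil G y z
  + (n%:R - 2%:R) * bil T y z.
Proof.
move=> sG pG; have hF := some_frameP sG pG.
rewrite /metric_trace; set F := some_frame G in hF *.
have Gu := orthonormal_frame_unitmx hF.
have GG : \sum_i bil G y (row i F) * bil G (row i F) z = bil G y z.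
  by rewrite (sum_bil_frame _ _ _ _ hF) mulmxV // mul1mx.
have GT : \sum_i bil G y (row i F) * bil T (row i F) z = bil T y z.
  by rewrite (sum_bil_frame _ _ _ _ hF) mulmxV // mul1mx.
have TG : \sum_i bil T y (row i F) * bil G (row i F) z = bil T y z.
  by rewrite (sum_bil_frame _ _ _ _ hF) mulmxKV.
have tG : \sum_i bil G (row i F) (row i F) = n%:R.
  by under eq_bigr do rewrite hF eqxx; rewrite sumr_const card_ord.
rewrite /wedge.
(* Every term becomes a factor independent of [i] times one of the sums computed above or the trace
   of [T]. *)
transitivity (\sum_i (
    (k * bil G y z + bil T y z) * bil G (row i F) (row i F)
    + (- k) * (bil G y (row i F) * bil G (row i F) z)
    + bil G y z * bil T (row i F) (row i F)
    + (-1) * (bil T y (row i F) * bil G (row i F) z)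
    + (-1) * (bil G y (row i F) * bil T (row i F) z))).
  by apply: eq_bigr => i _; ring.
rewrite !big_split -!mulr_sumr /= GG GT TG tG; ring.
Qed.

End Contraction.

(** * The Ricci tensor under the curvature formula *)

Section Ricci.
Variables (R : realType) (n : nat) (M : riemannian_manifold R n).

Definition form_prod_mx (al be : one_form M) (c : chart M) (p : M) : 'M[R]_n :=
  (fcomp al c p)^T *m fcomp be c p.

Lemma tens_prodE (al be : one_form M) c p x y :
  tens_prod al be c p x y = bil (form_prod_mx al be c p) x y.
Proof. by rewrite /form_prod_mx bil_outer. Qed.

Lemma sym_prodE (al be : one_form M) c p x y :
  sym_prod al be c p x y =
  bil (form_prod_mx al be c p + form_prod_mx be al c p) x y.
Proof. by rewrite bilDm -!tens_prodE. Qed.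

Lemma metric_traceD (G : 'M[R]_n) (B B' : 'rV[R]_n -> 'rV[R]_n -> R) :
  metric_trace G (fun x y => B x y + B' x y)
  = metric_trace G B + metric_trace G B'.
Proof. exact: big_split. Qed.

Lemma metric_traceZ (G : 'M[R]_n) (k : R) (B : 'rV[R]_n -> 'rV[R]_n -> R) :
  metric_trace G (fun x y => k * B x y) = k * metric_trace G B.
Proof. by rewrite /metric_trace mulr_sumr. Qed.

Variables (a : nat -> M -> R) (om : 'I_4 -> one_form M).
Variables (W : 'I_4 -> vector_field M) (d1 d2 : tensor2 M).
Hypothesis hstruct : structure_tensors om W d1 d2.

(** By duality the trace is the sum of [g(W_i, e_k) g(e_k, W_j)], which completeness of the frame
    collapses to [g(W_i, W_j)]. *)
Lemma metric_trace_tens_prod i j c p : dom c p ->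
  metric_trace (metric M c p) (tens_prod (om i) (om j) c p) = (i == j)%:R.
Proof.
move=> cp; case: hstruct => omE WW _ _ _; rewrite -(WW i j c p cp).
have sG := Defs.metric_sym cp; have pG := metric_posdef cp.
have hF := some_frameP sG pG.
have Gu := orthonormal_frame_unitmx hF.
transitivity (bil (metric M c p *m invmx (metric M c p) *m metric M c p)
  (W i c p) (W j c p)); last by rewrite mulmxV // mul1mx.
rewrite -(sum_bil_frame _ _ _ _ hF); apply: eq_bigr => k _.
by rewrite /tens_prod -!omE // /g sG.
Qed.

Lemma metric_trace_h_form c p : dom c p ->
  metric_trace (metric M c p) (h_form a om d1 d2 c p)
  = a 4%N p + a 5%N p + a 6%N p + a 7%N p.
Proof.
move=> cp; case: (hstruct) => _ _ _ [t1 t2] _.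
rewrite /h_form !(metric_traceD, metric_traceZ).
rewrite [metric_trace _ (fun x y => bil (d1 c p) x y)]t1 //.
rewrite [metric_trace _ (fun x y => bil (d2 c p) x y)]t2 //.
do ![rewrite [metric_trace _ (fun x y => tens_prod _ _ _ _ x y)]
  metric_trace_tens_prod //].
(* Deciding the index equalities in ['I_4] leaves only the four squares. *)
by rewrite /= !(mulr0, mulr1, addr0, add0r).
Qed.

Hypothesis hcurv : forall c p, dom c p -> forall x y z w,
  curvature c p x y z w =
    a 1%N p * gg c p x y z w + wedge (g c p) (h_form a om d1 d2 c p) x y z w.

Lemma ricci_quasi_constant c p x y : dom c p ->
  ricci c p x y =
    ((n%:R - 1) * a 1%N p + (a 4%N p + a 5%N p + a 6%N p + a 7%N p)) * g c p x y
    + (n%:R - 2%:R) * h_form a om d1 d2 c p x y.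
Proof.
move=> cp.
(* The contraction lemma takes a matrix; that of [h] is found by unification once all terms are
   gathered under one [bil]. *)
have [H hH] : exists H : 'M[R]_n, h_form a om d1 d2 c p = bil H.
  eexists; apply/funext => u; apply/funext => v.
  by rewrite /h_form !tens_prodE !sym_prodE -!bilZm -!bilDm; reflexivity.
have trH := metric_trace_h_form cp; rewrite hH in trH *.
rewrite -trH [_ * a 1%N p]mulrC.
rewrite -metric_trace_curvature; [|exact: Defs.metric_sym|exact: metric_posdef].
by apply: eq_bigr => i _; rewrite hcurv // hH.
Qed.

End Ricci.

(** * Matching with the shape required of a Co(QE)_n *)

(* Position of the coefficient of omega^(i+1) (x) omega^(j+1) in h. *)
Definition h_index (i j : nat) : nat :=
  nth 0%N (nth [::] [:: [:: 4; 8; 12; 9]; [:: 8; 5; 10; 11];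
                        [:: 12; 10; 6; 13]; [:: 9; 11; 13; 7]]%N i) j.

(** The coefficient of each symmetrized product fills two mirror entries of the table, those of the
    squares fill its diagonal. *)
Lemma h_formE (R : realType) (n : nat) (M : riemannian_manifold R n)
    (a : nat -> M -> R) (om : 'I_4 -> one_form M) (d1 d2 : tensor2 M) c p x y :
  h_form a om d1 d2 c p x y =
  \sum_(i < 4) \sum_(j < 4) a (h_index i j) p * form_eval (om i) c p x
                               * form_eval (om j) c p y
  + a 2%N p * bil (d1 c p) x y + a 3%N p * bil (d2 c p) x y.
Proof.
rewrite /h_form /tens_prod /sym_prod.
rewrite !big_ord_recr !big_ord0 /=.
(* Unrolling the sums yields indices built from [widen_ord] and [ord_max], to be identified with the
   numerals in [h_form]. *)
set o0 := widen_ord _ _; set o1 := widen_ord _ _.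
set o2 := widen_ord _ _.
have -> : o0 = 0 by apply/val_inj.
have -> : o1 = 1 by apply/val_inj.
have -> : o2 = 2%:R by apply/val_inj.
have -> : ord_max = 3%:R :> 'I_4 by apply/val_inj.
rewrite /h_index /=; ring.
Qed.

Theorem theorem5p3 (R : realType) (n : nat) (M : riemannian_manifold R n) :
  (3 < n)%N ->
  comprehensive_quasi_constant_curvature M ->
  comprehensive_quasi_Einstein M.
Proof.
move=> n3 [_ [a [om [W [d1 [d2 [ha hstruct hcurv]]]]]]].
have ricE := ricci_quasi_constant hstruct hcurv.
have [omE WW _ _ dW] := hstruct.
have sa i : (1 <= i <= 13)%N -> smooth_function (a i) by move=> /ha[].
have n2 : n%:R - 2%:R != 0 :> R.
  by rewrite subr_eq0 eqr_nat gtn_eqF // ltnW.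
have evW i j c p : dom c p -> form_eval (om i) c p (W j c p) = (i == j)%:R.
  by move=> cp; rewrite -omE // WW // eq_sym.
have ric_neq0 : ricci_nonzero M.
  (* The point is one where [a 8] does not vanish. *)
  have [//|_ [p ap]] := ha 8%N; have [c cp] := dom_cover p.
  exists c, p, (W 1 c p), (W 0 c p); split=> //.
  have [d1W d2W] := dW c p (W 1 c p) cp.
  rewrite ricE // WW // /h_form /tens_prod /sym_prod d1W d2W !evW //=.
  by rewrite !(mulr0, mul0r, mulr1, mul1r, addr0, add0r) mulf_neq0.
split=> //.
  move=> fl; case: ric_neq0 => c [p [x [y [cp]]]].
  by rewrite /ricci /metric_trace big1 ?eqxx // => i _; apply: fl.
(* The scalars are read off from [ricE], with [h] expanded by [h_formE]; forms, fields and tensors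
   are kept. *)
exists (fun p => (n%:R - 1) * a 1%N p
                 + (a 4%N p + a 5%N p + a 6%N p + a 7%N p)),
  (fun i j p => (n%:R - 2%:R) * a (h_index i j) p),
  (fun p => (n%:R - 2%:R) * a 2%N p), (fun p => (n%:R - 2%:R) * a 3%N p),
  om, W, d1, d2.
split=> //.
- split; try by apply: smooth_functionZ; apply: sa.
    apply: smooth_functionD; first by apply: smooth_functionZ; apply: sa.
    by do ![apply: smooth_functionD]; apply: sa.
  move=> i j; apply: smooth_functionZ; apply: sa.
  (* All sixteen table entries lie between 1 and 13. *)
  by case: i j => [[|[|[|[|]]]] //= ?] [[|[|[|[|]]]] //= ?].
- move=> i j p; congr (_ * a _ p).
  by case: i j => [[|[|[|[|]]]] //= ?] [[|[|[|[|]]]] //= ?].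
(* The non-zero scalar [a 1] supplies a point of the manifold; there [omega^i(W_i) = 1]. *)
- move=> i; have [//|_ [p _]] := ha 1%N; have [c cp] := dom_cover p.
  by exists c, p, (W i c p); rewrite evW // eqxx oner_neq0.
move=> c p cp x y; rewrite ricE // h_formE !mulrDr !addrA !mulrA.
congr (_ + _ + _ + _); rewrite mulr_sumr; apply: eq_bigr => i _.
by rewrite mulr_sumr; apply: eq_bigr => j _; rewrite !mulrA.
Qed.
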